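(* Let $\Gamma$ be a group generated by a finite symmetric set $S=S^{-1}\subset\Gamma$, and suppose that there are real constants $C>0$ and $d\ge 1$ such that the growth function satisfies $\gamma_S(n-1)\ge C n^d$ for every integer $n\ge 1$. Then for every finite non-empty subset $D\subset\Gamma$, $$\frac{|\partial_S D|}{|D|}\ \ge\ \frac{C^{1/d}\,d}{(d+1)^{1+\frac1d}}\ |D|^{-1/d}.$$
   Context: For an integer $r\ge 0$, $B_S(r)\subset\Gamma$ is the set of elements that can be written as a product of at most $r$ elements of $S$ (so $B_S(0)=\{e\}$), and $\gamma_S(r)=|B_S(r)|$. The (inner) boundary of $D\subset\Gamma$ is $\partial_S D=\{x\in D : \exists s\in S,\ sx\notin D\}$. *)

(* Defs.v *)
From HB Require Import structures.
From mathcomp Require Import all_boot all_order all_algebra.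
From mathcomp Require Import finmap.
From mathcomp Require Import all_classical all_reals all_analysis.

Set Implicit Arguments.
Unset Strict Implicit.
Unset Printing Implicit Defensive.

Import Order.TTheory GRing.Theory Num.Theory.

Local Open Scope group_scope.
Local Open Scope fset_scope.
Local Open Scope classical_set_scope.

Section Growth.
Variables (G : groupType) (S : {fset G}).

Definition symmetric_fset : Prop := [fset s^-1 | s in S] = S.

(* Every subgroup containing S is the whole group. *)
Definition generates : Prop :=
  forall H : {pred G}, group_closed H -> {subset S <= H} -> forall x, x \in H.

Definition word_ball (r : nat) : set G :=
  [set x | exists w : seq G,
     [/\ (size w <= r)%N, {subset w <= S} & x = \prod_(s <- w) s]].

Lemma finite_word_ball r : finite_set (word_ball r).
Proof.
elim: r => [|r IHr].
  apply: (@sub_finite_set _ _ [set 1]); last exact: finite_set1.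
  by move=> x [w [+ _ ->]]; case: w => //= _; rewrite big_nil.
apply: (@sub_finite_set _ _ ([set 1] `|`
    (fun p => p.1 * p.2) @` ([set` S] `*` word_ball r))).
  move=> x [[|s w] [/= size_w wS ->]]; first by left; rewrite big_nil.
  right; exists (s, \prod_(t <- w) t) => /=; last by rewrite big_cons.
  split; first by apply: wS; rewrite mem_head.
  by exists w; split=> // t tw; apply: wS; rewrite inE tw orbT.
rewrite finite_setU; split; first exact: finite_set1.
apply: finite_image; apply: finite_setX => //; exact: finite_fset.
Qed.

(* [fset_set] is empty on infinite sets; [finite_word_ball] shows that this
   case does not occur. *)
Definition growth (r : nat) : nat := #|` fset_set (word_ball r)|.

Definition inner_boundary (D : {fset G}) : {fset G} :=
  [fset x in D | has (fun s => s * x \notin D) S].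

End Growth.

(* Main.v *)
(* If g is a product of at most r generators, any x in D with g x outside D
   leaves D along the corresponding path, and it does so at a point of the
   boundary: hence at most r |bd D| points of D are moved out of D by g.  On the
   other hand, with g ranging over the ball B(r), at most |D|^2 pairs (g, x)
   in B(r) x D satisfy g x \in D.  Therefore |D| (1 - |D| / |B(r)|) <= r |bd D|.
   Taking r = floor ((lambda |D| / C)^(1/d)) ensures |B(r)| >= lambda |D|, and
   lambda = d + 1 gives the best constant. *)
Require Import Defs.
From HB Require Import structures.
From mathcomp Require Import all_boot all_order all_algebra.
From mathcomp Require Import finmap.
From mathcomp Require Import all_classical all_reals all_analysis.
From mathcomp Require Import lra ring.

Import Order.TTheory GRing.Theory Num.Theory.

Local Open Scope fset_scope.
Local Open Scope ring_scope.

Section BoundaryEstimate.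
Local Open Scope nat_scope.
Local Open Scope group_scope.
Variables (G : groupType) (S D : {fset G}).

(** The head letter [s] acts last. If the tail product [p] has not yet moved x out of D, then
    [p * x] is a point of D that [s] pushes out, hence a boundary point. Such x lie in the translate
    of the boundary by [p^-1], so each letter costs at most one copy of the boundary. *)
Lemma card_escape (w : seq G) : {subset w <= S} ->
  #|` [fset x in D | (\prod_(s <- w) s) * x \notin D]|
    <= size w * #|` inner_boundary S D|.
Proof.
elim: w => [_|s w IHw wS].
  rewrite big_nil mul0n leqn0 cardfs_eq0; apply/eqP/fsetP => x.
  by rewrite !inE mul1g andbN.
set p := \prod_(t <- w) t.
have sub : [fset x in D | (\prod_(t <- s :: w) t) * x \notin D] `<=`
    [fset p^-1 * y | y in inner_boundary S D] `|` [fset x in D | p * x \notin D].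
  apply/fsubsetP => x; rewrite !inE /= big_cons -/p => /andP[xD spx].
  have [pxD|pxD] := boolP (p * x \in D); last by rewrite xD orbT.
  apply/orP; left; apply/imfsetP; exists (p * x) => /=; last by rewrite mulKg.
  rewrite !inE pxD /=; apply/hasP; exists s; first by apply: wS; rewrite mem_head.
  by rewrite mulgA.
apply: leq_trans (fsubset_leq_card sub) _.
apply: leq_trans (leq_card_fsetU _ _) _; rewrite mulSn leq_add //.
  exact: leq_imfset_card.
by apply: IHw => t tw; apply: wS; rewrite inE tw orbT.
Qed.

(** Swap the sums: for a fixed x in D, the map sending g to [g * x] is injective, and the g counted
    land in D, so there are at most |D| of them. *)
Lemma sum_card_stay (K : {fset G}) :
  \sum_(g <- K) #|` [fset x in D | (g * x)%g \in D]| <= #|` D| * #|` D|.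
Proof.
have card_filter (A : {fset G}) (P : pred G) :
    #|` [fset x in A | P x]| = \sum_(x <- A) P x.
  rewrite card_fset_sum1 big_fset /= big_mkcond.
  by apply: eq_bigr => x _; case: (P x).
under eq_bigr do rewrite card_filter.
rewrite exchange_big /=.
have -> : (#|` D| * #|` D|)%N = \sum_(x <- D) #|` D|.
  by rewrite big_const_seq iter_addn_0 count_predT.
apply: leq_sum => x _; rewrite -card_filter.
set Kx := [fset g in K | _].
have <- : #|` [fset g * x | g in Kx]| = #|` Kx|.
  by apply: card_imfset; exact: mulIg.
apply: fsubset_leq_card; apply/fsubsetP => y /imfsetP[g /=].
by rewrite !inE => /andP[_ +] ->.
Qed.

(** The averaged estimate multiplied by |B(r)|, which avoids division and subtraction in [nat]. *)
Lemma growth_boundary (r : nat) :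
  growth S r * #|` D| <=
    #|` D| * #|` D| + growth S r * (r * #|` inner_boundary S D|).
Proof.
rewrite /growth; set K := fset_set _.
have sumK c : \sum_(g <- K) c = (#|` K| * c)%N.
  by rewrite big_const_seq iter_addn_0 count_predT mulnC.
rewrite -!sumK.
apply: leq_trans (leq_add (sum_card_stay K) (leqnn _)).
rewrite -big_split /=; rewrite big_seq [leqRHS]big_seq; apply: leq_sum => g.
rewrite in_fset_set; last exact: finite_word_ball.
rewrite inE => -[w [size_w wS ->]].
(* For each g of the ball, D splits into the points that stay in D and those that escape. *)
rewrite -(cardfsID [fset x in D | (\prod_(s <- w) s) * x \in D] D).
apply: leq_add.
  by apply: fsubset_leq_card; exact: fsubsetIr.
apply: leq_trans (leq_mul size_w (leqnn _)).
apply: leq_trans (card_escape w wS); apply: fsubset_leq_card.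
by apply/fsubsetP => x; rewrite !inE => /andP[+ xD]; rewrite xD.
Qed.

End BoundaryEstimate.

Theorem corollary3p7 (R : realType) (Gamma : groupType) (S : {fset Gamma})
    (C d : R)
    (S_sym : symmetric_fset S)
    (S_gen : generates S)
    (C_gt0 : 0 < C)
    (d_ge1 : 1 <= d)
    (S_growth : forall n : nat, (1 <= n)%N ->
       C * (n%:R `^ d) <= (growth S (n - 1)%N)%:R)
    (D : {fset Gamma}) (D_neq0 : D != fset0) :
  (C `^ (1 / d) * d) / ((d + 1) `^ (1 + 1 / d))
    * ((#|` D|)%:R `^ (- (1 / d)))
  <= (#|` inner_boundary S D|)%:R / (#|` D|)%:R.
Proof.
set b : R := (#|` inner_boundary S D|)%:R.
set a : R := (#|` D|)%:R.
have a_gt0 : 0 < a by rewrite ltr0n cardfs_gt0.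
have d_gt0 : 0 < d by lra.
pose t := ((d + 1) * a / C) `^ (1 / d).
have t_gt0 : 0 < t by rewrite powR_gt0 // divr_gt0 // mulr_gt0 //; lra.
have t_d : C * t `^ d = (d + 1) * a.
  rewrite /t -powRrM mul1r mulVf ?gt_eqF // powRr1; last first.
    by rewrite divr_ge0 ?mulr_ge0 ?ltW //; lra.
  by rewrite mulrC divfK ?gt_eqF.
(* All fractional powers are absorbed in [t]; what remains to prove amounts to
   [d * a <= (d + 1) * t * b]. *)
have -> : C `^ (1 / d) * d / (d + 1) `^ (1 + 1 / d) * a `^ (- (1 / d)) =
    d / ((d + 1) * t).
  have d1_gt0 : 0 < d + 1 by lra.
  have invC : C^-1 `^ (1 / d) = (C `^ (1 / d))^-1.
    by rewrite -[C^-1]powR_inv1 ?ltW // powRAC powR_inv1 ?powR_ge0.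
  rewrite /t powRM ?powRM ?invr_ge0 ?mulr_ge0 ?ltW // invC.
  rewrite powRD ?(gt_eqF d1_gt0) ?implybT // powRr1 ?ltW // powRN.
  have := powR_gt0 (1 / d) C_gt0; have := powR_gt0 (1 / d) a_gt0.
  have := powR_gt0 (1 / d) d1_gt0.
  move: (C `^ _) (a `^ _) (_ `^ _) => u v w w0 v0 u0.
  by field; rewrite !gt_eqF.
pose r := Num.truncn t.
have r_le_t : r%:R <= t by rewrite truncn_le ltW.
have := growth_boundary _ S D r.
rewrite -(ler_nat R) natrD !natrM -/a -/b.
have : (d + 1) * a <= (growth S r)%:R.
  (* The shift in the growth hypothesis pays for the rounding: at n = r + 1 it bounds |B(r)| below
     by C (r + 1)^d, and r + 1 > t. *)
  rewrite -t_d; have := S_growth r.+1 isT; rewrite subn1; apply: le_trans.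
  rewrite ler_pM2l // ge0_ler_powR ?ltW ?nnegrE ?ler0n ?truncnS_gt //.
  exact: ltW.
move: (growth S r)%:R => g g_ge averaged.
have b_ge0 : 0 <= b by rewrite ler0n.
have g_gt0 : 0 < g by apply: lt_le_trans g_ge; rewrite mulr_gt0 //; lra.
(* As [a <= g / (d + 1)], the term [a * a] takes at most the fraction 1 / (d + 1) of [g * a]; then
   [g] cancels. *)
have ra_le : d * a <= (d + 1) * (r%:R * b).
  rewrite -(ler_pM2l g_gt0); nra.
rewrite ler_pdivlMr // mulrAC ler_pdivrMr ?mulr_gt0 //; last by lra.
apply: le_trans ra_le _; rewrite [leRHS]mulrC -mulrA ler_pM2l; last by lra.
exact: ler_wpM2r.
Qed.
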